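(* Let $1\le L\le N<M$ be integers, let $X$ be an $M\times N$ complex matrix such that $K=\frac1N XX^{*}$ has rank $N$, and let $\Phi$ be an isotropically random $L\times M$ matrix with $\Phi\Phi^*=I_L$. Then $$\mathrm{cov}_L(K):=\mathbb{E}_\Phi\big(\Phi^{*}(\Phi K\Phi^{*})\Phi\big)=\frac{L}{(M^2-1)M}\Big[(ML-1)K+(M-L)\,\mathrm{Tr}(K)\,I_M\Big].$$
   Context: $A^*$ denotes the conjugate transpose, $I_n$ the $n\times n$ identity matrix, and $\mathrm{Tr}$ the non-normalized trace. ''Isotropically random'' means that $\Phi$ is distributed according to the Haar probability measure on $\{\Phi\in\mathbb{C}^{L\times M}:\Phi\Phi^*=I_L\}$, i.e. the unique probability measure invariant under $\Phi\mapsto\Phi\Theta$ for every $M\times M$ unitary $\Theta$. *)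

(* Defs.v *)
From HB Require Import structures.
From mathcomp Require Import all_boot all_order all_algebra.
From mathcomp Require Import all_classical all_reals all_analysis.
From mathcomp Require Import complex.

Set Implicit Arguments.
Unset Strict Implicit.
Unset Printing Implicit Defensive.

Import Order.TTheory GRing.Theory Num.Theory.
Import numFieldNormedType.Exports.

Local Open Scope classical_set_scope.
Local Open Scope ring_scope.
Local Open Scope complex_scope.
Local Open Scope sesquilinear_scope.

(* The topology of the modulus on R[i]. The library only attaches it to terms
   of the form [sort F] with F : numClosedFieldType, which R[i] is not
   syntactically. *)
HB.instance Definition _ (R : rcfType) :=
  PseudoPointedMetric.copy R[i] ((R[i] : numClosedFieldType)^o).

(* Complex matrices with the Borel sigma-algebra of the entrywise topology. *)
Notation borel_mx R m n := (g_sigma_algebraType (@open 'M[R[i]]_(m, n))).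

Section isotropic.
Variable R : realType.

(* mu is the Haar probability measure on {Phi | Phi Phi^* = I_L}, viewed as a
   measure on all L x M matrices: it is carried by that set and is invariant
   under right multiplication by unitary matrices. For a rectangular matrix,
   [\is unitarymx] says exactly Phi *m Phi^t* = 1%:M. *)
Definition is_haar_stiefel (L M : nat) (mu : probability (borel_mx R L M) R) :
    Prop :=
  {ae mu, forall Phi : borel_mx R L M, (Phi : 'M[R[i]]_(L, M)) \is unitarymx} /\
  forall Theta : 'M[R[i]]_M, Theta \is unitarymx ->
  forall A : set (borel_mx R L M), measurable A ->
    mu [set Phi : borel_mx R L M | A ((Phi : 'M[R[i]]_(L, M)) *m Theta)] = mu A.

Context (d : measure_display) (Omega : measurableType d)
  (P : probability Omega R).

Definition isotropically_random (L M : nat) (Phi : {RV P >-> borel_mx R L M}) :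
    Prop :=
  is_haar_stiefel (distribution P Phi).

(* [fine] sends infinite values to 0. This does not occur below: the entries of
   a matrix with Phi Phi^* = I_L are bounded by 1, so every integrand in [cov]
   is almost surely bounded. *)
Definition cexpectation (Z : Omega -> R[i]) : R[i] :=
  (fine 'E_P[fun w => complex.Re (Z w)])
    +i* (fine 'E_P[fun w => complex.Im (Z w)]).

Definition mx_expectation (m n : nat) (Z : Omega -> 'M[R[i]]_(m, n)) :
    'M[R[i]]_(m, n) :=
  \matrix_(i, j) cexpectation (fun w => Z w i j).

Definition cov (L M : nat) (Phi : {RV P >-> borel_mx R L M}) (K : 'M[R[i]]_M) :
    'M[R[i]]_M :=
  mx_expectation (fun w =>
    let F : 'M[R[i]]_(L, M) := Phi w in F^t* *m (F *m K *m F^t*) *m F).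

End isotropic.

(* Main.v *)
Require Import Defs.
From HB Require Import structures.
From mathcomp Require Import all_boot all_order all_algebra.
From mathcomp Require Import all_classical all_reals all_analysis.
From mathcomp Require Import complex.
From mathcomp Require Import measurable_realfun fingroup perm ring.

(**
The map [K |-> E (Phi^* Phi K Phi^* Phi)] is linear and, by invariance of the
law of [Phi], commutes with conjugation by unitary matrices. Such a map has the
form [K |-> a K + b (\tr K) I]: sign matrices and transpositions force this on
a diagonal matrix unit, unitary conjugation carries it to all rank-one matrices
[v v^*], and these span by polarization.

The two coefficients follow from two traces. With [Q = Phi^* Phi], a projection
of rank [L], taking [K = I] gives [a M + b M^2 = E (\tr Q) = L], and summing
the [(i, j)] entries of the images of the matrix units [E_ij] gives
[a M^2 + b M = E ((\tr Q)^2) = L^2].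
*)

Set Implicit Arguments.
Unset Strict Implicit.
Unset Printing Implicit Defensive.

Import Order.TTheory GRing.Theory Num.Theory.
Import numFieldNormedType.Exports.

Local Open Scope classical_set_scope.
Local Open Scope ring_scope.
Local Open Scope complex_scope.
Local Open Scope sesquilinear_scope.

(** * Unitarily equivariant linear maps *)

Section equivariant.
Variable C : numClosedFieldType.

Lemma sign_diag_unitary n (k : 'I_n) :
  diag_mx (\row_j (-1) ^+ (j == k)) \is @unitarymx C n n.
Proof.
apply/unitarymxP; rewrite tr_diag_mx; apply/matrixP => i j.
rewrite mul_diag_mx !mxE; case: (eqVneq i j) => [->|_] /=.
  by rewrite mulr1n rmorphXn rmorphN rmorph1 -expr2 sqrr_sign.
by rewrite mulr0n rmorph0 mulr0.
Qed.

Lemma conj_sign_diag n (k : 'I_n) (B : 'M[C]_n) i j :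
  let D := diag_mx (\row_j (-1) ^+ (j == k)) in
  (D *m B *m D^t*) i j = (-1) ^+ (i == k) * B i j * (-1) ^+ (j == k).
Proof.
rewrite /= tr_diag_mx map_diag_mx mul_mx_diag mul_diag_mx !mxE.
by rewrite rmorphXn rmorphN rmorph1.
Qed.

Lemma trmxC_perm n (s : 'S_n) : (perm_mx s)^t* = perm_mx s^-1 :> 'M[C]_n.
Proof.
by rewrite tr_perm_mx; apply/matrixP => i j; rewrite !mxE rmorph_nat.
Qed.

Lemma perm_mx_unitary n (s : 'S_n) : perm_mx s \is @unitarymx C n n.
Proof.
by apply/unitarymxP; rewrite trmxC_perm -perm_mxM mulgV perm_mx1.
Qed.

Lemma conj_perm_mx n (s : 'S_n) (B : 'M[C]_n) i j :
  (perm_mx s *m B *m (perm_mx s)^t*) i j = B (s i) (s j).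
Proof. by rewrite trmxC_perm -row_permE -col_permE !mxE. Qed.

(* [schmidt] of a matrix with first row [u] is unitary and its first row spans
   the same line as [u]. *)
Lemma unitary_rank1 n (u : 'rV[C]_n.+1) : exists c, exists2 U : 'M[C]_n.+1,
  U \is unitarymx & u^t* *m u = c *: (U *m delta_mx 0 0 *m U^t*).
Proof.
pose A : 'M[C]_n.+1 := \matrix_i u.
have /sub_rVP[c cE] : (u <= row 0 (schmidt A))%MS.
  (* Gram-Schmidt puts row 0 of [A] in the span of the rows of [schmidt A] of index at most 0, that
     is, of row 0 alone. *)
  have := row_schmidt_sub A 0; rewrite rowK => /submx_trans; apply.
  apply/sumsmx_subP => i; rewrite leqn0 => /eqP i0.
  by rewrite genmxE (_ : i = 0) //; apply/val_inj.
(* With [s] the unit row 0 of [schmidt A], [u = c *: s] gives [u^t* *m u] as |c|^2 times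
   [s^t* *m s], and [s] is the basis row 0 times [schmidt A]. *)
exists (Num.conj c * c), ((schmidt A)^t*).
  by rewrite trmxC_unitary schmidt_unitarymx.
rewrite trmxCK {1 2}cE -(mul_delta_mx (0 : 'I_1)) mulmxA -mulmxA -rowE.
have -> : (c *: row 0 (schmidt A))^t* =
    Num.conj c *: ((schmidt A)^t* *m delta_mx 0 0).
  by rewrite linearZ rowE /= trmx_mul trmx_delta map_mxZ map_mxM map_delta_mx.
by rewrite -scalemxAl -scalemxAr scalerA.
Qed.

(** Complex polarization: the form [H (u^t* *m v)] is antisymmetric by expanding at [u + v].
    Replacing [v] by ['i *: v] makes it symmetric as well, hence zero. Basis rows then give all
    matrix units. *)
Lemma linear_rank1_eq0 n (V : lmodType C) (H : {linear 'M[C]_n -> V}) :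
  (forall u : 'rV_n, H (u^t* *m u) = 0) -> forall K, H K = 0.
Proof.
move=> H0; have HZ c B : H (c *: B) = c *: H B by rewrite linearZ.
have polD (u v : 'rV_n) : H (u^t* *m v) + H (v^t* *m u) = 0.
  have := H0 (u + v); rewrite [(u + v)^T]linearD map_mxD mulmxDl !mulmxDr !linearD /= !H0.
  by rewrite add0r addr0.
have polE (u v : 'rV_n) : H (u^t* *m v) = 0.
  have := polD u ('i *: v).
  rewrite [('i *: v)^T]linearZ map_mxZ -scalemxAl -scalemxAr !linearZ /= conjCi scaleNr.
  rewrite -scalerBr => /eqP; rewrite scaler_eq0 (negbTE (neq0Ci C)) /= subr_eq0 => /eqP uv.
  have /eqP := polD u v; rewrite -uv -mulr2n -scaler_nat scaler_eq0 pnatr_eq0 /=.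
  by move/eqP.
move=> K; rewrite [K]matrix_sum_delta raddf_sum big1 // => i _.
rewrite raddf_sum big1 // => j _; apply: etrans (HZ _ _) _.
have := polE (delta_mx 0 i) (delta_mx 0 j).
by rewrite trmx_delta map_delta_mx mul_delta_mx => ->; rewrite scaler0.
Qed.

Variables (n : nat) (G : 'M[C]_n.+2 -> 'M[C]_n.+2).
Hypothesis G_linear : linear G.
Hypothesis G_equivariant : forall U K, U \is unitarymx ->
  G (U *m K *m U^t*) = U *m G K *m U^t*.

(** The image of a matrix unit is fixed by every unitary conjugation that fixes the unit itself. The
    size [n.+2] ensures that index 1 exists. *)
Lemma unitary_equivariant_delta : exists a b,
  G (delta_mx 0 0) = a *: delta_mx 0 0 + b%:M.
Proof.
set E := delta_mx 0 0; set A := G E.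
have stab (U : 'M[C]_n.+2) : U \is unitarymx -> U *m E *m U^t* = E ->
    A = U *m A *m U^t*.
  by move=> uU UE; rewrite -G_equivariant // UE.
have offdiag i j : i != j -> A i j = 0.
  (* Flipping the sign of coordinate [i] fixes [E] but negates [A i j]. *)
  move=> ij; set D : 'M[C]_n.+2 := diag_mx (\row_k (-1) ^+ (k == i)).
  have DE : D *m E *m D^t* = E.
    apply/matrixP => k l; rewrite conj_sign_diag !mxE.
    case: (eqVneq k 0) => [->|_]; last by rewrite mulr0 mul0r.
    case: (eqVneq l 0) => [->|_]; last by rewrite mulr0 mul0r.
    by rewrite mulr1 -expr2 sqrr_sign.
  have /matrixP/(_ i j) := stab D (sign_diag_unitary i) DE.
  rewrite conj_sign_diag eqxx (eq_sym j) (negbTE ij) mulr1 mulN1r => /eqP.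
  by rewrite -addr_eq0 -mulr2n mulrn_eq0 => /eqP.
have diag i : i != 0 -> A i i = A 1 1.
  (* Neither [i] nor 1 is 0, so this transposition fixes index 0 and hence [E]. *)
  move=> i0; set s := tperm i 1.
  have s0 k : (s k == 0) = (k == 0).
    by rewrite -{1}(@tpermD _ i 1 0) // (inj_eq perm_inj).
  have sE : perm_mx s *m E *m (perm_mx s)^t* = E.
    by apply/matrixP => k l; rewrite conj_perm_mx !mxE !s0.
  have /matrixP/(_ i i) := stab (perm_mx s) (perm_mx_unitary s) sE.
  by rewrite conj_perm_mx tpermL.
(* [b] is the common diagonal value away from index 0, and [a] is the excess of the corner entry
   over it. *)
exists (A 0 0 - A 1 1), (A 1 1); apply/matrixP => i j; rewrite !mxE.
case: (eqVneq i j) => [<-|ij].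
  rewrite andbb; case: (eqVneq i 0) => [->|i0]; first by rewrite mulr1 mulr1n subrK.
  by rewrite mulr0 add0r mulr1n diag.
rewrite offdiag // mulr0n addr0; case: (eqVneq i 0) ij => [->|_ _]; last by rewrite mulr0.
by rewrite eq_sym => /negbTE ->; rewrite mulr0.
Qed.


(** The difference [H] between [G] and the candidate is linear, so it suffices that it vanish on the
    matrices [u^t* *m u], which are multiples of unitary conjugates of [delta_mx 0 0]. *)
Lemma unitary_equivariant_linear : exists a b,
  forall K, G K = a *: K + (b * \tr K)%:M.
Proof.
have [a [b GE]] := unitary_equivariant_delta; exists a, b.
pose H K : 'M[C]_n.+2 := G K - (a *: K + (b * \tr K)%:M).
have H_linear : linear H.
  move=> c K1 K2; apply/matrixP => i j.
  rewrite /H G_linear mxtraceD mxtraceZ !mxE.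
  by case: (i == j); rewrite ?mulr1n ?mulr0n; ring.
pose HL := GRing.isLinear.Build _ _ _ _ H H_linear.
pose h : {linear _ -> _} := HB.pack H HL.
suff H0 K : h K = 0.
  by move=> K; have /eqP := H0 K; rewrite /= subr_eq0 => /eqP.
apply: linear_rank1_eq0 => u /=.
have [c [U uU ->]] := unitary_rank1 u; apply: etrans (linearZ_LR h _ _) _.
have Ut : U^t* *m U = 1%:M by apply/mulmx1C/unitarymxP.
(* Conjugation by [U] preserves the trace, here 1, and fixes scalar matrices, so the formula for
   [delta_mx 0 0] carries over. *)
rewrite /= /H G_equivariant // mxtrace_mulC mulmxA Ut mul1mx GE.
rewrite -{3}(mul_delta_mx (0 : 'I_1)) mxtrace_mulC mul_delta_mx trace_mx11 mxE mulr1.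
rewrite mulmxDr mulmxDl -scalemxAr -scalemxAl mul_mx_scalar -scalemxAl.
by rewrite (unitarymxP uU) scalemx1 subrr scaler0.
Qed.

End equivariant.

(** * Expectations of almost surely bounded complex functions *)

Section bounded.
Context (R : realType) (d : measure_display) (T : measurableType d)
  (P : probability T R).

(** Unlike integrability, this condition is stable under products, so it passes to all polynomials
    in the entries of a random matrix. *)
Definition ae_bounded (f : T -> R) :=
  measurable_fun [set: T] f /\ exists c : R, {ae P, forall w, `|f w| <= c}.

Lemma ae_bounded_integrable f : ae_bounded f -> P.-integrable [set: T] (EFin \o f).
Proof.
move=> [mf [c fc]]; apply/integrableP; split; first exact/measurable_EFinP.
apply: (@le_lt_trans _ _ (\int[P]_(x in [set: T]) cst `|c|%:E x)%E).
  apply: ae_ge0_le_integral => //.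
  - by apply: measurableT_comp => //; exact/measurable_EFinP.
  - by move=> x _; rewrite lee_fin.
  - by apply: filterS fc => x fx _ /=; rewrite lee_fin (le_trans fx) // ler_norm.
by rewrite integral_cst //= probability_setT mule1 ltry.
Qed.

Lemma ae_bounded_cst c : ae_bounded (cst c).
Proof. by split => //; exists `|c|; exact: aeW. Qed.

Lemma ae_boundedD f g : ae_bounded f -> ae_bounded g ->
  ae_bounded (fun w => f w + g w).
Proof.
move=> [mf [c fc]] [mg [e ge]]; split; first exact: measurable_funD.
exists (c + e); apply: filterS2 fc ge => w fw gw.
by rewrite (le_trans (ler_normD _ _)) // lerD.
Qed.

Lemma ae_boundedM f g : ae_bounded f -> ae_bounded g ->
  ae_bounded (fun w => f w * g w).
Proof.
move=> [mf [c fc]] [mg [e ge]]; split; first exact: measurable_funM.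
by exists (c * e); apply: filterS2 fc ge => w fw gw; rewrite normrM ler_pM.
Qed.

Lemma ae_boundedN f : ae_bounded f -> ae_bounded (fun w => - f w).
Proof.
move=> [mf [c fc]]; split; first exact: measurableT_comp.
by exists c; apply: filterS fc => w; rewrite normrN.
Qed.

Local Notation Ef f := (fine 'E_P[f]).

Lemma fine_expectationD f g : ae_bounded f -> ae_bounded g ->
  Ef (fun w => f w + g w) = Ef f + Ef g.
Proof.
move=> /ae_bounded_integrable /Lfun1_integrable fb.
move=> /ae_bounded_integrable /Lfun1_integrable gb.
by rewrite (expectationD fb gb) fineD // expectation_fin_num.
Qed.

Lemma fine_expectationZ c f : ae_bounded f -> Ef (fun w => c * f w) = c * Ef f.
Proof.
move=> /ae_bounded_integrable /Lfun1_integrable fb.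
rewrite -[RHS]/(fine c%:E * _) -fineM // ?expectation_fin_num // -expectationZl //.
by congr (fine (expectation _ _)); apply/funext => w; rewrite mulrC.
Qed.

Lemma fine_expectation_ae_cst c f : measurable_fun [set: T] f ->
  {ae P, forall w, f w = c} -> Ef f = c.
Proof.
move=> mf fc; rewrite unlock (ae_eq_integral (cst c%:E)) //.
- by rewrite integral_cst //= probability_setT mule1.
- exact/measurable_EFinP.
- by apply: filterS fc => w -> _.
Qed.

Definition cbounded (Z : T -> R[i]) :=
  ae_bounded (fun w => complex.Re (Z w)) /\ ae_bounded (fun w => complex.Im (Z w)).

Lemma cbounded_cst c : cbounded (cst c).
Proof. by split; exact: ae_bounded_cst. Qed.

Lemma cboundedD Z W : cbounded Z -> cbounded W -> cbounded (fun w => Z w + W w).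
Proof.
move=> [Zr Zi] [Wr Wi]; split.
  by under eq_fun do rewrite raddfD; exact: ae_boundedD.
by under eq_fun do rewrite raddfD; exact: ae_boundedD.
Qed.

Lemma cboundedM Z W : cbounded Z -> cbounded W -> cbounded (fun w => Z w * W w).
Proof.
have ReM (x y : R[i]) : complex.Re (x * y) =
    complex.Re x * complex.Re y + - (complex.Im x * complex.Im y).
  by case: x y => [? ?] [? ?].
have ImM (x y : R[i]) : complex.Im (x * y) =
    complex.Re x * complex.Im y + complex.Im x * complex.Re y.
  by case: x y => [? ?] [? ?].
move=> [Zr Zi] [Wr Wi]; split.
  under eq_fun do rewrite ReM.
  by apply: ae_boundedD; [|apply: ae_boundedN]; apply: ae_boundedM.
under eq_fun do rewrite ImM.
by apply: ae_boundedD; apply: ae_boundedM.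
Qed.

Lemma cbounded_conj Z : cbounded Z -> cbounded (fun w => Num.conj (Z w)).
Proof.
move=> [Zr Zi]; split.
  rewrite (_ : (fun _ => _) = (fun w => complex.Re (Z w))) //.
  by apply/funext => w; case: (Z w).
rewrite (_ : (fun _ => _) = (fun w => - complex.Im (Z w))).
  exact: ae_boundedN.
by apply/funext => w; case: (Z w).
Qed.

Lemma cbounded_sum I (r : seq I) (Z : I -> T -> R[i]) :
  (forall i, cbounded (Z i)) -> cbounded (fun w => \sum_(i <- r) Z i w).
Proof.
move=> Zb; elim: r => [|i r IHr].
  by under eq_fun do rewrite big_nil; exact: cbounded_cst.
by under eq_fun do rewrite big_cons; exact: cboundedD.
Qed.

Lemma cexpectationD Z W : cbounded Z -> cbounded W ->
  cexpectation P (fun w => Z w + W w) = cexpectation P Z + cexpectation P W.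
Proof.
move=> [Zr Zi] [Wr Wi]; rewrite /cexpectation.
under eq_fun do rewrite raddfD.
under [X in _ +i* fine 'E_P[X]]eq_fun do rewrite raddfD.
by congr (_ +i* _); exact: fine_expectationD.
Qed.

Lemma cexpectationZ c Z : cbounded Z ->
  cexpectation P (fun w => c * Z w) = c * cexpectation P Z.
Proof.
case: c => a b [Zr Zi].
have Eab (x y : R) f g : ae_bounded f -> ae_bounded g ->
    Ef (fun w => x * f w + y * g w) = x * Ef f + y * Ef g.
  move=> fb gb; rewrite fine_expectationD ?fine_expectationZ //;
  by apply: ae_boundedM => //; exact: ae_bounded_cst.
apply/eqP; rewrite eq_complex; apply/andP; split; apply/eqP => /=.
  rewrite -mulNr -Eab //; congr (fine (expectation _ _)); apply/funext => w.
  by case: (Z w) => ? ? /=; rewrite mulNr.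
rewrite -Eab //; congr (fine (expectation _ _)); apply/funext => w.
by case: (Z w).
Qed.

Lemma cexpectation_sum I (r : seq I) (Z : I -> T -> R[i]) :
  (forall i, cbounded (Z i)) ->
  cexpectation P (fun w => \sum_(i <- r) Z i w) = \sum_(i <- r) cexpectation P (Z i).
Proof.
move=> Zb; elim: r => [|i r IHr].
  rewrite big_nil; under eq_fun do rewrite big_nil.
  by rewrite /cexpectation !expectation_cst.
rewrite big_cons -IHr -cexpectationD //; last exact: cbounded_sum.
by congr cexpectation; apply/funext => w; rewrite big_cons.
Qed.

Lemma cexpectation_ae_cst c Z : cbounded Z -> {ae P, forall w, Z w = c} ->
  cexpectation P Z = c.
Proof.
case: c => a b [[mr _] [mi _]] Zc; rewrite /cexpectation.
by congr (_ +i* _); apply: fine_expectation_ae_cst => //; apply: filterS Zc => w ->.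
Qed.

(** * Entrywise expectations of random matrices *)

Definition mx_bounded m n (Z : T -> 'M[R[i]]_(m, n)) :=
  forall i j, cbounded (fun w => Z w i j).

Lemma mx_bounded_cst m n (A : 'M[R[i]]_(m, n)) : mx_bounded (cst A).
Proof. by move=> i j; exact: cbounded_cst. Qed.

Lemma mx_boundedM m n p (Z : T -> 'M[R[i]]_(m, n)) (W : T -> 'M[R[i]]_(n, p)) :
  mx_bounded Z -> mx_bounded W -> mx_bounded (fun w => Z w *m W w).
Proof.
move=> Zb Wb i j; under eq_fun do rewrite mxE.
by apply: cbounded_sum => k; exact: cboundedM.
Qed.

Lemma mx_bounded_trC m n (Z : T -> 'M[R[i]]_(m, n)) :
  mx_bounded Z -> mx_bounded (fun w => (Z w)^t*).
Proof.
by move=> Zb i j; under eq_fun do rewrite !mxE; exact: cbounded_conj.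
Qed.

Lemma mx_expectationD m n (Z W : T -> 'M[R[i]]_(m, n)) :
  mx_bounded Z -> mx_bounded W ->
  mx_expectation P (fun w => Z w + W w) = mx_expectation P Z + mx_expectation P W.
Proof.
move=> Zb Wb; apply/matrixP => i j; rewrite !mxE -cexpectationD //.
by under eq_fun do rewrite mxE.
Qed.

Lemma mx_expectation_mull m n p (A : 'M[R[i]]_(m, n)) (Z : T -> 'M[R[i]]_(n, p)) :
  mx_bounded Z -> mx_expectation P (fun w => A *m Z w) = A *m mx_expectation P Z.
Proof.
move=> Zb; apply/matrixP => i j; rewrite !mxE.
under eq_fun do rewrite mxE.
rewrite cexpectation_sum => [|k]; last by apply: cboundedM => //; exact: cbounded_cst.
by apply: eq_bigr => k _; rewrite mxE cexpectationZ.
Qed.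

Lemma mx_expectation_mulr m n p (A : 'M[R[i]]_(n, p)) (Z : T -> 'M[R[i]]_(m, n)) :
  mx_bounded Z -> mx_expectation P (fun w => Z w *m A) = mx_expectation P Z *m A.
Proof.
move=> Zb; apply/matrixP => i j; rewrite !mxE.
under eq_fun do rewrite mxE.
rewrite cexpectation_sum => [|k]; last by apply: cboundedM => //; exact: cbounded_cst.
apply: eq_bigr => k _; rewrite mxE mulrC -cexpectationZ //.
by under eq_fun do rewrite mulrC.
Qed.

Lemma mx_expectationZ m n c (Z : T -> 'M[R[i]]_(m, n)) :
  mx_bounded Z -> mx_expectation P (fun w => c *: Z w) = c *: mx_expectation P Z.
Proof.
move=> Zb; apply/matrixP => i j; rewrite !mxE -cexpectationZ //.
by under eq_fun do rewrite mxE.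
Qed.

End bounded.

(** * The Haar measure on the Stiefel manifold *)

Section topo.
Variable R : realType.

Lemma continuous_Re : continuous (fun z : R[i] => complex.Re z : R).
Proof.
move=> z B /(nbhs_ballP (complex.Re z)) [e e0 eB]; apply/nbhs_ballP.
exists e%:C; first by rewrite /= ltcR.
move=> w zw; apply: eB; rewrite /ball /= -ltcR; apply: le_lt_trans zw.
by rewrite -raddfB; exact: normc_ge_Re.
Qed.

Lemma normc_ge_Im (z : R[i]) : `|complex.Im z|%:C <= `|z|.
Proof.
(* Multiplication by ['i] preserves the modulus and turns the imaginary part into a real part, up to
   sign. *)
rewrite -normrN -ReiNIm; apply: le_trans (normc_ge_Re _) _.
by rewrite complexiE normrM normCi mulr1.
Qed.

Lemma continuous_Im : continuous (fun z : R[i] => complex.Im z : R).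
Proof.
move=> z B /(nbhs_ballP (complex.Im z)) [e e0 eB]; apply/nbhs_ballP.
exists e%:C; first by rewrite /= ltcR.
move=> w zw; apply: eB; rewrite /ball /= -ltcR; apply: le_lt_trans zw.
by rewrite -raddfB; exact: normc_ge_Im.
Qed.

Lemma continuous_entry m n (i : 'I_m) (j : 'I_n) :
  continuous (fun A : 'M[R[i]]_(m, n) => A i j).
Proof.
move=> A B AB; exists (fun k l => if (k == i) && (l == j) then B else setT).
  move=> k l; case: ifP => [/andP[/eqP-> /eqP->] //|_]; exact: filterT.
by move=> M /(_ i j); rewrite !eqxx.
Qed.

Lemma continuous_mulmxr m n p (A : 'M[R[i]]_(n, p)) :
  continuous (fun B : 'M[R[i]]_(m, n) => B *m A).
Proof.
move=> B S /(nbhs_ballP (B *m A)) [e /= e0 eS]; apply/nbhs_ballP.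
(* [c] bounds the Lipschitz constant of the map in the entrywise maximum norm. The summand 1 keeps
   it positive when [A] is zero and makes the final inequality strict. *)
pose c : R[i] := 1 + \sum_k \sum_j `|A k j|.
have c0 : 0 < c by rewrite ltr_pwDl // sumr_ge0 // => k _; rewrite sumr_ge0.
exists (e / c); first by rewrite /= divr_gt0.
move=> M [_ BM]; apply: eS; split=> // i j.
have {}BM k : `|B i k - M i k| < e / c := BM i k.
rewrite /ball /= /ball_ /= !mxE -sumrB.
apply: le_lt_trans (ler_norm_sum _ _ _) _.
have : e / c * \sum_k \sum_j `|A k j| < e.
  rewrite mulrAC ltr_pdivrMr // ltr_pM2l //.
  by rewrite /c ltrDr.
apply: le_lt_trans; rewrite mulr_sumr ler_sum // => k _.
rewrite -mulrBl normrM ler_pM ?(ltW (BM k)) //.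
by rewrite (bigD1 j) //= lerDl sumr_ge0.
Qed.

Lemma continuous_measurable_real m n (f : 'M[R[i]]_(m, n) -> R) :
  continuous f -> measurable_fun [set: borel_mx R m n] f.
Proof.
move=> /continuousP cf; apply: (measurability _ (RGenOpens.measurableE R)).
move=> _ [_ [a [b ->] <-]]; rewrite setTI; apply: sub_sigma_algebra.
exact/cf/interval_open.
Qed.

Lemma continuous_measurable_borel m n p q (f : 'M[R[i]]_(m, n) -> 'M[R[i]]_(p, q)) :
  continuous f -> measurable_fun [set: borel_mx R m n]
    (f : borel_mx R m n -> borel_mx R p q).
Proof.
move=> /continuousP cf; apply: (@measurability _ _ (borel_mx R m n)
  (borel_mx R p q) [set: _] f (@open 'M[R[i]]_(p, q)) erefl).
move=> _ [B oB <-]; rewrite setTI; apply: sub_sigma_algebra.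
exact: cf.
Qed.

End topo.

(** The integrand of [cov] as a function of the matrix alone, so that it can be integrated against
    the law of [Phi]. *)
Definition compress (R : realType) L M (K : 'M[R[i]]_M) (F : 'M[R[i]]_(L, M)) :
  'M[R[i]]_M := F^t* *m (F *m K *m F^t*) *m F.

(** * The covariance map of the Haar measure *)

Section haar.
Variables (R : realType) (L M : nat) (mu : probability (borel_mx R L M) R).
Hypothesis muH : is_haar_stiefel mu.
Local Notation T := (borel_mx R L M).

(** Almost surely the rows of [F] are unit vectors, so every entry has modulus at most 1. *)
Lemma haar_bounded : mx_bounded mu (fun F : T => F : 'M[R[i]]_(L, M)).
Proof.
have F1 : {ae mu, forall F : T, forall i j, `|(F : 'M[R[i]]_(L, M)) i j| <= 1}.
  apply: filterS muH.1 => F /unitarymxP/matrixP FF i j.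
  have := FF i i; rewrite !mxE eqxx mulr1n => FFi.
  rewrite -(@ler_pXn2r _ 2) ?nnegrE // expr1n -FFi (bigD1 j) //= !mxE -normCK.
  by rewrite lerDl sumr_ge0 // => k _; rewrite !mxE mul_conjC_ge0.
move=> i j; split; split.
- apply: continuous_measurable_real => F B FB.
  exact: (continuous_entry (i := i) (j := j) (continuous_Re FB)).
- exists 1; apply: filterS F1 => F /(_ i j); rewrite -lecR; apply: le_trans.
  exact: normc_ge_Re.
- apply: continuous_measurable_real => F B FB.
  exact: (continuous_entry (i := i) (j := j) (continuous_Im FB)).
- exists 1; apply: filterS F1 => F /(_ i j); rewrite -lecR; apply: le_trans.
  exact: normc_ge_Im.
Qed.

(** Change of variables: invariance says that right multiplication by [Theta] pushes [mu] forward to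
    itself. *)
Lemma haar_expectation (Theta : 'M[R[i]]_M) (f : T -> R) : Theta \is unitarymx ->
  let f' F := f ((F : 'M[R[i]]_(L, M)) *m Theta) in
  ae_bounded mu f -> ae_bounded mu f' -> ('E_mu[f'] = 'E_mu[f])%E.
Proof.
move=> uTheta f' [mf _] /ae_bounded_integrable f'i; rewrite unlock.
pose phi (F : T) : T := (F : 'M[R[i]]_(L, M)) *m Theta.
have mphi : measurable_fun [set: T] phi.
  exact: (continuous_measurable_borel (@continuous_mulmxr R L M M Theta)).
have muE A : measurable A -> A `<=` setT -> pushforward mu phi A = mu A.
  by move=> mA _; apply: muH.2.
have {}mf : measurable_fun [set: T] (EFin \o f) by apply/measurable_EFinP.
rewrite -[RHS](eq_measure_integral _ muE).
by rewrite (integral_pushforward mphi mf f'i).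
Qed.

Lemma haar_mx_expectation m n (Theta : 'M[R[i]]_M) (Z : T -> 'M[R[i]]_(m, n)) :
  Theta \is unitarymx ->
  let Z' F := Z ((F : 'M[R[i]]_(L, M)) *m Theta) in
  mx_bounded mu Z -> mx_bounded mu Z' ->
  mx_expectation mu Z' = mx_expectation mu Z.
Proof.
move=> uTheta Z' Zb Z'b; apply/matrixP => i j; rewrite !mxE /cexpectation.
have [Zr Zi] := Zb i j; have [Z'r Z'i] := Z'b i j.
by congr (fine _ +i* fine _);
  [exact: haar_expectation Zr Z'r|exact: haar_expectation Zi Z'i].
Qed.

Definition haar_cov (K : 'M[R[i]]_M) : 'M[R[i]]_M :=
  mx_expectation mu (fun F : T => compress K (F : 'M[R[i]]_(L, M))).

Lemma mx_bounded_compress (Z : T -> 'M[R[i]]_(L, M)) K :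
  mx_bounded mu Z -> mx_bounded mu (fun F => compress K (Z F)).
Proof.
move=> Zb; have Zb' := mx_bounded_trC Zb.
apply: mx_boundedM => //; apply: mx_boundedM => //; apply: mx_boundedM => //.
by apply: mx_boundedM => //; exact: mx_bounded_cst.
Qed.

Lemma haar_cov_linear : linear haar_cov.
Proof.
move=> c K1 K2; rewrite /haar_cov -mx_expectationZ; last first.
  exact: mx_bounded_compress _ haar_bounded.
rewrite -mx_expectationD.
- congr mx_expectation; apply/funext => F.
  by rewrite /compress mulmxDr !mulmxDl mulmxDr mulmxDl -!(scalemxAl, scalemxAr).
- move=> i j; under eq_fun do rewrite mxE.
  apply: cboundedM; first exact: cbounded_cst.
  exact: (mx_bounded_compress _ haar_bounded).
- exact: mx_bounded_compress _ haar_bounded.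
Qed.

Lemma haar_cov_equivariant U K : U \is unitarymx ->
  haar_cov (U *m K *m U^t*) = U *m haar_cov K *m U^t*.
Proof.
move=> uU.
have Kb := mx_bounded_compress K haar_bounded.
rewrite -mx_expectation_mull // -mx_expectation_mulr; last first.
  by apply: mx_boundedM => //; exact: mx_bounded_cst.
have uUt : U^t* \is unitarymx by rewrite trmxC_unitary.
(* Replace [F] by [F *m U^t*]. The products [U^t* *m U] on both sides of [K] cancel, leaving only
   the outer [U] and [U^t*]. *)
rewrite /haar_cov -(haar_mx_expectation uUt (mx_bounded_compress _ haar_bounded)).
  congr mx_expectation; apply/funext => F /=.
  rewrite /compress trmx_mul map_mxM trmxCK !mulmxA.
  by rewrite !(mulmxKtV _ uU erefl).
apply: mx_bounded_compress; apply: mx_boundedM; first exact: haar_bounded.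
exact: mx_bounded_cst.
Qed.

(** The integrand is almost surely constant: it reduces to the trace of [F^t* *m F], which by
    cyclicity is that of [F *m F^t*], the identity of size [L]. *)
Lemma haar_cov1_trace : \tr (haar_cov 1%:M) = L%:R.
Proof.
rewrite /mxtrace; under eq_bigr do rewrite mxE.
have Kb := mx_bounded_compress 1%:M haar_bounded.
rewrite -cexpectation_sum => [|i]; last exact: Kb.
apply: cexpectation_ae_cst; first by apply: cbounded_sum => i; exact: Kb.
apply: filterS muH.1 => F /unitarymxP FF; rewrite -/(\tr _) /compress.
by rewrite mulmx1 FF mulmx1 mxtrace_mulC FF mxtrace1.
Qed.

(** The entry [(i, j)] of [Q *m delta_mx i j *m Q] is [Q i i * Q j j], so the double sum inside the
    expectation factors as the square of [\tr Q]. *)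
Lemma haar_cov_delta_sum : \sum_i \sum_j haar_cov (delta_mx i j) i j = L%:R ^+ 2.
Proof.
have Kb K := mx_bounded_compress K haar_bounded.
under eq_bigr => i _.
  under eq_bigr do rewrite mxE.
  rewrite -cexpectation_sum => [|j]; last exact: Kb.
  over.
rewrite -cexpectation_sum => [|i]; last by apply: cbounded_sum => j; exact: Kb.
apply: cexpectation_ae_cst.
  by do 2 (apply: cbounded_sum => ?); exact: Kb.
apply: filterS muH.1 => F /unitarymxP FF.
pose Q : 'M[R[i]]_M := (F : 'M[R[i]]_(L, M))^t* *m F.
have QE i j : compress (delta_mx i j) (F : 'M[R[i]]_(L, M)) i j = Q i i * Q j j.
  have -> : compress (delta_mx i j) (F : 'M[R[i]]_(L, M)) = Q *m delta_mx i j *m Q.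
    by rewrite /compress /Q !mulmxA.
  (* Writing the matrix unit as a column times a row turns the product into column [i] of [Q] times
     row [j] of [Q]. *)
  rewrite -(mul_delta_mx (0 : 'I_1)) mulmxA -mulmxA -colE -rowE.
  by rewrite mxE big_ord1 !mxE.
under eq_bigr do under eq_bigr do rewrite QE.
under eq_bigr do rewrite -mulr_sumr.
by rewrite -mulr_suml -expr2 -/(\tr Q) mxtrace_mulC FF mxtrace1.
Qed.

End haar.

(** * The two coefficients, and the transfer to the random matrix *)

Lemma haar_covE (R : realType) L M (mu : probability (borel_mx R L M) R) K :
  (1 < M)%N -> is_haar_stiefel mu -> haar_cov mu K =
  (L%:R / ((M%:R ^+ 2 - 1) * M%:R)) *:
      ((M%:R * L%:R - 1) *: K + ((M%:R - L%:R) * \tr K)%:M).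
Proof.
case: M mu K => [|[|n]] // mu K _ muH.
have [a [b covE]] := unitary_equivariant_linear (haar_cov_linear muH)
  (haar_cov_equivariant muH).
(* [N] is here the ambient dimension [M] as a complex number, not a number of columns. *)
set N : R[i] := n.+2%:R; set l : R[i] := L%:R.
have tr1 : a * N + b * N * N = l.
  rewrite /l -(haar_cov1_trace muH) covE mxtraceD mxtraceZ mxtrace1 mxtrace_scalar.
  by congr (_ + _); exact: mulr_natr.
have tr2 : a * N ^+ 2 + b * N = l ^+ 2.
  rewrite /l -(haar_cov_delta_sum muH).
  have row_sum (i : 'I_n.+2) : \sum_j haar_cov mu (delta_mx i j) i j = a * N + b.
    (* The matrix unit contributes [a] to every entry. The scalar part contributes only for [j = i],
       where both the trace and the identity entry are 1. *)
    have entry j : haar_cov mu (delta_mx i j) i j = a + (if j == i then b else 0).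
      have trd : \tr (delta_mx i j) = (i == j)%:R :> R[i].
        rewrite /mxtrace (bigD1 i) //= mxE eqxx big1 ?addr0 // => k ki.
        by rewrite mxE (negbTE ki).
      rewrite covE trd !mxE !eqxx mulr1 (eq_sym j).
      by case: eqP => _; rewrite ?mulr1 ?mulr1n ?mulr0 ?mulr0n.
    under eq_bigr do rewrite entry.
    by rewrite big_split /= sumr_const card_ord -big_mkcond big_pred1_eq mulr_natr.
  under eq_bigr do rewrite row_sum.
  by rewrite sumr_const card_ord -mulr_natr -/N; ring.
have N0 : N != 0 by rewrite pnatr_eq0.
have N1 : N ^+ 2 - 1 != 0 by rewrite subr_eq0 -natrX pnatr_eq1.
have D0 : (N ^+ 2 - 1) * N != 0 by rewrite mulf_neq0.
(* Eliminating [b]: [N] times [tr2] minus [tr1] leaves [a * (N ^+ 2 - 1) * N]. *)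
have aE : a = l / ((N ^+ 2 - 1) * N) * (N * l - 1).
  apply: (mulIf D0); rewrite mulrAC divfK //.
  transitivity (N * (a * N ^+ 2 + b * N) - (a * N + b * N * N)); first by ring.
  by rewrite tr1 tr2; ring.
(* Eliminating [a]: [N] times [tr1] minus [tr2] leaves [b * (N ^+ 2 - 1) * N]. *)
have bE : b = l / ((N ^+ 2 - 1) * N) * (N - l).
  apply: (mulIf D0); rewrite mulrAC divfK //.
  transitivity (N * (a * N + b * N * N) - (a * N ^+ 2 + b * N)); first by ring.
  by rewrite tr1 tr2; ring.
by rewrite covE scalerDr scalerA -aE scale_scalar_mx mulrA -bE.
Qed.

Theorem mainTheorem3 (R : realType) (d : measure_display)
    (Omega : measurableType d) (P : probability Omega R) (L M N : nat)
    (hL : (1 <= L)%N) (hLN : (L <= N)%N) (hNM : (N < M)%N)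
    (X : 'M[R[i]]_(M, N)) (K : 'M[R[i]]_M)
    (hK : K = N%:R^-1 *: (X *m X^t*)) (hrank : \rank K = N)
    (Phi : {RV P >-> borel_mx R L M}) (hPhi : isotropically_random Phi) :
  cov Phi K =
    (L%:R / ((M%:R ^+ 2 - 1) * M%:R)) *:
      ((M%:R * L%:R - 1) *: K + ((M%:R - L%:R) * \tr K)%:M).
Proof.
(* The chain 1 ≤ L ≤ N < M keeps the denominator nonzero. *)
have M1 : (1 < M)%N by apply: leq_ltn_trans hNM; exact: leq_trans hLN.
rewrite -(haar_covE _ M1 hPhi).
have Kb := mx_bounded_compress K (haar_bounded hPhi).
have mPhi : measurable_fun [set: Omega] Phi by exact: measurable_funP.
(* Expectations under [P] of functions of [Phi] are expectations under its law, to which the Haar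
   computation applies. *)
have EPhi f : ae_bounded (distribution P Phi) f ->
    ('E_P[f \o Phi] = 'E_(distribution P Phi)[f])%E.
  move=> [mf [c fc]]; rewrite unlock.
  have mf' : measurable_fun [set: _] (EFin \o f) by apply/measurable_EFinP.
  rewrite (integral_pushforward mPhi mf') ?preimage_setT //.
  apply: (@ae_bounded_integrable _ _ _ P (f \o Phi)); split.
    exact: measurableT_comp.
  (* The exceptional null set of the law pulls back along [Phi] to a null set of [P]. *)
  case: fc => A [mA PA fA]; exists c, (Phi @^-1` A); split => //.
    by rewrite -[X in measurable X]setTI; exact: mPhi.
  by move=> w fw; exact: fA.
apply/matrixP => i j; rewrite !mxE /cexpectation; have [Kr Ki] := Kb i j.
by rewrite -(EPhi _ Kr) -(EPhi _ Ki).
Qed.
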